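(* Assume that the following conditions hold. (A1) The Markov chain $(Z(t))$ is irreducible on $E\subset\mathbb{Z}^d$. (A2) There are $C>0$ and $\delta_0>0$ such that $$\sup_{\alpha\in\mathbb{R}^d:\ \|\alpha\|\le\delta_0}\ \sup_{x\in E}\ \mathbb{E}_x\bigl(\exp(\alpha\cdot(Z(1)-x))\bigr)<C .$$ (A3) $u\in\mathbb{Z}^d\setminus\{0\}$ is such that $E+u\subset E$ and $p(x+u,y+u)\ge p(x,y)$ for all $x,y\in E$. (A4) For some integer $\tilde n\ge 1$, $\inf_{x\in E}\mathbb{P}_x(Z(\tilde n)=x+u)>0$. Let $(y_n)$ be a sequence of points of $E$ with $\lim_n\|y_n\|=+\infty$ and $$\liminf_{n\to\infty}\frac{1}{\|y_n\|}\log G(0,y_n)\ge 0 .$$ Then for any $z\in E$, $$\liminf_{n\to\infty}\frac{G(z+u,y_n)}{G(z,y_n)}\ge 1 .$$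
   Context: $(Z(t))_{t\in\mathbb{N}}$ is a transient sub-stochastic time-homogeneous Markov chain on a countable set $E\subset\mathbb{Z}^d$ with $0\in E$, with transition probabilities $p(x,y)$, $x,y\in E$, so $\sum_{y\in E}p(x,y)\le 1$. It is completed by an absorbing (cemetery) state $\vartheta$ with $p(x,\vartheta)=1-\sum_{y\in E}p(x,y)$, $p(\vartheta,\vartheta)=1$. $\mathbb{P}_x$, $\mathbb{E}_x$ denote probability and expectation for the initial state $Z(0)=x$; expectations of functions of $Z(1)$ are taken over $Z(1)\in E$ only, e.g. $\mathbb{E}_x(\exp(\alpha\cdot(Z(1)-x)))=\sum_{y\in E}p(x,y)\exp(\alpha\cdot(y-x))$. The Green function is $G(x,y)=\sum_{n=0}^\infty\mathbb{P}_x(Z(n)=y)$, $x,y\in E$. $\|\cdot\|$ is the Euclidean norm and $\alpha\cdot x$ the usual scalar product in $\mathbb{R}^d$. *)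

(* Defs.v *)
From HB Require Import structures.
From mathcomp Require Import all_boot all_order all_algebra.
From mathcomp Require Import all_classical all_reals all_analysis.

Set Implicit Arguments.
Unset Strict Implicit.
Unset Printing Implicit Defensive.

Import Order.TTheory GRing.Theory Num.Theory.
Import numFieldNormedType.Exports.

Local Open Scope classical_set_scope.
Local Open Scope ring_scope.

Definition dotp (R : realType) (d : nat) (a b : 'rV[R]_d) : R :=
  \sum_(i < d) a 0 i * b 0 i.

(* The library's norm on ['rV[R]_d] is the sup norm, hence this definition. *)
Definition enorm (R : realType) (d : nat) (a : 'rV[R]_d) : R :=
  Num.sqrt (dotp a a).

Definition realpt (R : realType) (d : nat) (x : 'rV[int]_d) : 'rV[R]_d :=
  map_mx (fun k : int => k%:~R) x.

Definition substochastic (R : realType) (d : nat) (E : set 'rV[int]_d)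
    (p : 'rV[int]_d -> 'rV[int]_d -> R) : Prop :=
  (forall x y, E x -> E y -> 0 <= p x y) /\
  (forall x, E x -> (\esum_(y in E) (p x y)%:E <= 1)%E).

(* [Some x] is the point [x] and [None] the cemetery. Only the points of [E]
   and the cemetery are states; the values of [trans] elsewhere are never
   used. *)
Definition is_state (d : nat) (E : set 'rV[int]_d)
    (s : option 'rV[int]_d) : Prop :=
  if s is Some x then E x else True.

Definition trans (R : realType) (d : nat) (E : set 'rV[int]_d)
    (p : 'rV[int]_d -> 'rV[int]_d -> R) (s t : option 'rV[int]_d) : \bar R :=
  match s, t with
  | Some x, Some y => (p x y)%:E
  | Some x, None => (1 - \esum_(y in E) (p x y)%:E)%E
  | None, Some _ => 0%E
  | None, None => 1%E
  end.

Definition history (d : nat) (Omega : Type)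
    (Z : nat -> Omega -> option 'rV[int]_d) (s : nat -> option 'rV[int]_d)
    (n : nat) : set Omega :=
  [set w | forall k, (k <= n)%N -> Z k w = s k].

(* The state space is countable, so measurability of every [Z n] amounts to
   measurability of the events [Z n = s]. The last clause is the
   time-homogeneous Markov property
     P_x(Z(n+1) = s_(n+1) | Z(0) = s_0, ..., Z(n) = s_n) = trans s_n s_(n+1),
   multiplied by the probability of the conditioning event. The measures [P x]
   are constrained only for [x] in [E]. *)
Definition markov_chain (R : realType) (d : nat) (E : set 'rV[int]_d)
    (p : 'rV[int]_d -> 'rV[int]_d -> R)
    (dO : measure_display) (Omega : measurableType dO)
    (P : 'rV[int]_d -> probability Omega R)
    (Z : nat -> Omega -> option 'rV[int]_d) : Prop :=
  [/\ forall n w, is_state E (Z n w),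
      forall n s, measurable [set w | Z n w = s],
      forall x, E x -> P x [set w | Z 0%N w = Some x] = 1%E
    & forall x, E x -> forall (s : nat -> option 'rV[int]_d) (n : nat),
        (forall k, is_state E (s k)) ->
        P x (history Z s n.+1) =
          (P x (history Z s n) * trans E p (s n) (s n.+1))%E].

Definition irreducible_on (R : realType) (d : nat) (E : set 'rV[int]_d)
    (dO : measure_display) (Omega : measurableType dO)
    (P : 'rV[int]_d -> probability Omega R)
    (Z : nat -> Omega -> option 'rV[int]_d) : Prop :=
  forall x y, E x -> E y ->
    exists n : nat, (0 < P x [set w | Z n w = Some y])%E.

Definition transient_on (R : realType) (d : nat) (E : set 'rV[int]_d)
    (dO : measure_display) (Omega : measurableType dO)
    (P : 'rV[int]_d -> probability Omega R)
    (Z : nat -> Omega -> option 'rV[int]_d) : Prop :=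
  forall x, E x ->
    (P x [set w | exists n : nat, (1 <= n)%N /\ Z n w = Some x] < 1)%E.

Definition green (R : realType) (d : nat)
    (dO : measure_display) (Omega : measurableType dO)
    (P : 'rV[int]_d -> probability Omega R)
    (Z : nat -> Omega -> option 'rV[int]_d) (x y : 'rV[int]_d) : \bar R :=
  (\sum_(0 <= n <oo) P x [set w | Z n w = Some y])%E.

(* E_x(exp(alpha . (Z(1) - x))), the cemetery contributing nothing. *)
Definition exp_moment (R : realType) (d : nat) (E : set 'rV[int]_d)
    (p : 'rV[int]_d -> 'rV[int]_d -> R)
    (alpha : 'rV[R]_d) (x : 'rV[int]_d) : \bar R :=
  (\esum_(y in E) (p x y * expR (dotp alpha (realpt R (y - x))))%:E)%E.

(* Main.v *)
Require Import Defs.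
From HB Require Import structures.
From mathcomp Require Import all_boot all_order all_algebra.
From mathcomp Require Import all_classical all_reals all_analysis.
From mathcomp Require Import ring lra.

Set Implicit Arguments.
Unset Strict Implicit.
Unset Printing Implicit Defensive.

Import Order.TTheory GRing.Theory Num.Theory.
Import numFieldNormedType.Exports.

Local Open Scope classical_set_scope.
Local Open Scope ring_scope.

(** Write [p^n(x, y)] for the [n]-step transition probabilities, [f^u] for the
    function [w |-> f (w + u)], and [T] for the operator of [nt] steps of the
    chain, where [nt] and [eps > 0] satisfy [p^nt(x, x + u) >= eps] for all
    [x].

    The idea is that every block of [nt] steps contains, with probability
    exactly [eps], a translation by [u] that can be moved to the beginning of
    the path. Indeed [T = Q + eps S], where [S f = f^u] and [Q] is given by the
    nonnegative kernel [p^nt(x, w) - eps 1(w = x + u)]. Expanding [T^n] in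
    words in [Q] and [eps S], let [N] be the number of letters [S]; it is
    binomial with parameters [n] and [eps], except for the mass that the chain
    loses. Monotonicity of [p] under translation by [u] gives [T S <= S T], so
    in each word any of its [N] letters [S] may be moved to the front, which
    only increases the word. Counting the choices yields
      E_x(N f(X_n)) <= n eps (T^(n-1) f)(x + u)
    ([marked_count_le]). Since [N >= (1 - dl) n eps] outside an event of
    probability exponentially small in [n] ([marked_exp_le]), this gives
      (1 - dl) p^m(x, y) <= p^(m - nt)(x + u, y) + exp(kap (nt - m))
    ([mixop_shift_ratio], [ktrans_shift_ratio]).

    On the other hand the exponential moments bound [p^m(x, y)] by
    [exp(L m - r |y - x|)] ([ktrans_le_exp_enorm]). The error above is thus at
    most the smaller of two exponentials, one decaying in [m] and the other
    in [|y - x|], hence at most their weighted geometric mean, and with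
    suitable weights this mean decays in both. Summing over [m]
    ([kgreen_shift]),
      (1 - dl) G(x, y) <= G(x + u, y) + C exp(- t r |y - x|).
    By irreducibility [G(z, y_n)] is at least a constant times [G(0, y_n)],
    which by assumption decays slower than any exponential of [|y_n|], so the
    last term is negligible with respect to [G(z, y_n)]; and [dl] is
    arbitrary. That [G] is finite follows from transience by a renewal
    argument ([kgreen_diag_le]).

    The estimates on [p^m] and [G], except the exponential moment bound, hold
    for nonnegative kernels on arbitrary index types and are proved at that
    level. They are applied to the type of the points of [E], which removes
    all membership conditions; [prob_at_ktrans] and [hitting_le_return] relate
    the kernel to the chain.
*)

(** * Kernels acting on nonnegative functions *)

Section Operators.
Context {R : realType} {T : choiceType}.
Implicit Types (k : T -> T -> \bar R) (f g : T -> \bar R).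
Local Open Scope ereal_scope.

Lemma le_term_esum (a : T -> \bar R) t :
  (forall i, 0 <= a i) -> a t <= \esum_(i in [set: T]) a i.
Proof.
move=> a0; apply: esum_ge; exists [set t]; last by rewrite fsbig_set1.
by split => //; exact: finite_set1.
Qed.

(** The factor may be infinite, as functions are integrated against kernels
    without any boundedness assumption. *)
Lemma ge0_esumZl (c : \bar R) (a : T -> \bar R) : 0 <= c ->
  (forall i, 0 <= a i) ->
  \esum_(i in [set: T]) (c * a i) = c * \esum_(i in [set: T]) a i.
Proof.
have le_Z (b : \bar R) (d : T -> \bar R) : 0 <= b -> (forall i, 0 <= d i) ->
    \esum_(i in [set: T]) (b * d i) <= b * \esum_(i in [set: T]) d i.
  move=> b0 d0; apply: ge_ereal_sup => _ [X [finX XT] <-].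
  rewrite -ge0_mule_fsumr// lee_wpmul2l//.
  by apply: esum_ge; exists X.
move=> c0 a0; apply/eqP; rewrite eq_le le_Z//=.
have ca0 i : 0 <= c * a i by exact: mule_ge0.
case: c c0 ca0 => [c| |]// c0 ca0.
- have [->|cn0] := eqVneq c 0%R.
    by rewrite mul0e esum_ge0// => i _; rewrite mul0e.
  have {c0 cn0} c0 : (0 < c)%R by rewrite lt_neqAle eq_sym cn0.
  have -> : \esum_(i in [set: T]) a i =
            \esum_(i in [set: T]) (c^-1%:E * (c%:E * a i)).
    apply: eq_esum => i _.
    by rewrite muleA -EFinM mulVf ?gt_eqF// mul1e.
  apply: (@le_trans _ _
      (c%:E * (c^-1%:E * \esum_(i in [set: T]) (c%:E * a i)))).
    rewrite lee_wpmul2l ?lee_fin ?(ltW c0)//.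
    by rewrite le_Z ?lee_fin ?invr_ge0 ?(ltW c0).
  by rewrite muleA -EFinM divff ?gt_eqF// mul1e.
- have [[t at0]|/forallNP na] := pselect (exists t, 0 < a t).
    apply: le_trans (leey _) _.
    by have := le_term_esum t ca0; rewrite gt0_mulye.
  rewrite (_ : \esum_(_ in _) a _ = 0) ?mule0 ?esum_ge0//.
  apply: esum1 => i _; apply/eqP; rewrite eq_le a0 andbT leNgt.
  by apply/negP; exact: na.
Qed.

Lemma exchange_esum (a : T -> T -> \bar R) : (forall i j, 0 <= a i j) ->
  \esum_(i in [set: T]) \esum_(j in [set: T]) a i j =
  \esum_(j in [set: T]) \esum_(i in [set: T]) a i j.
Proof.
move=> a0; rewrite !(esum_esum (J := fun=> setT))//.
rewrite (@reindex_esum _ _ _ (setT `*`` (fun=> setT)) _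
  (fun x : T * T => (x.2, x.1)))//.
split=> //=; first by move=> [i j] [i' j'] _ _ [-> ->].
by move=> [i j] _; exists (j, i).
Qed.

Lemma reindex_le_esum (h : T -> T) (a : T -> \bar R) : injective h ->
  (forall i, 0 <= a i) ->
  \esum_(i in [set: T]) a (h i) <= \esum_(i in [set: T]) a i.
Proof.
move=> hI a0; rewrite -(@esum_image _ _ _ setT h); last by move=> i j _ _ /hI.
rewrite esum_mkcond; apply: le_esum => i _; by case: ifP.
Qed.

Definition kop k f x := \esum_(w in [set: T]) (k x w * f w).
Definition delta (w : T) : T -> \bar R := fun x => (x == w)%:R%:E.

Lemma delta_ge0 w x : 0 <= delta w x.
Proof. by rewrite lee_fin ler0n. Qed.

Lemma esum_delta f w : (forall x, 0 <= f x) ->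
  \esum_(x in [set: T]) (delta w x * f x) = f w.
Proof.
move=> f0; rewrite (esumID [set w]); last first.
  by move=> i _; rewrite mule_ge0 ?delta_ge0.
rewrite setTI esum_set1 ?mule_ge0 ?delta_ge0// [X in _ + X]esum1.
  by rewrite adde0 /delta eqxx mul1e.
by move=> i [_ /= /eqP/negPf]; rewrite /delta => ->; rewrite mul0e.
Qed.

Section fixed_kernel.
Variable k : T -> T -> \bar R.
Hypothesis k0 : forall x w, 0 <= k x w.

Lemma kop_ge0 f x : (forall w, 0 <= f w) -> 0 <= kop k f x.
Proof. by move=> f0; apply: esum_ge0 => w _; exact: mule_ge0. Qed.

Lemma le_kop f g x : (forall w, f w <= g w) -> kop k f x <= kop k g x.
Proof. by move=> fg; apply: le_esum => w _; exact: lee_wpmul2l. Qed.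

Lemma kopD f g x : (forall w, 0 <= f w) -> (forall w, 0 <= g w) ->
  kop k (fun w => f w + g w) x = kop k f x + kop k g x.
Proof.
move=> f0 g0; rewrite /kop -esumD; last 2 first.
- by move=> w _; exact: mule_ge0.
- by move=> w _; exact: mule_ge0.
by apply: eq_esum => w _; rewrite ge0_muleDr.
Qed.

Lemma kopZ (c : \bar R) f x : 0 <= c -> (forall w, 0 <= f w) ->
  kop k (fun w => c * f w) x = c * kop k f x.
Proof.
move=> c0 f0; rewrite /kop -ge0_esumZl//; last by move=> w; exact: mule_ge0.
by apply: eq_esum => w _; rewrite muleCA.
Qed.

Lemma le_kop_term f x w : (forall v, 0 <= f v) -> k x w * f w <= kop k f x.
Proof.
move=> f0; apply: (le_term_esum (a := fun v => k x v * f v)) => v.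
exact: mule_ge0.
Qed.

Lemma iter_kop_ge0 n f x : (forall w, 0 <= f w) -> 0 <= iter n (kop k) f x.
Proof. by move=> f0; elim: n x => [//|n IH] x; apply: kop_ge0. Qed.

Lemma iter_kop_le1 n f x :
  (forall x, kop k (cst 1) x <= 1) -> (forall w, f w <= 1) ->
  iter n (kop k) f x <= 1.
Proof.
move=> k1 f1; elim: n x => [//|n IH] x /=.
by apply: le_trans (k1 x); apply: le_kop.
Qed.

(** The powers of a kernel operator are again given by a kernel, so that one
    block of several steps can be decomposed like a single step. *)
Lemma iter_kopE n f x : (forall w, 0 <= f w) ->
  iter n (kop k) f x = kop (fun x w => iter n (kop k) (delta w) x) f x.
Proof.
move=> f0; elim: n x => [|n IH] x /=.
  rewrite -[LHS]esum_delta//; apply: eq_esum => w _.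
  by rewrite /= /delta eq_sym.
have D0 w v : 0 <= iter n (kop k) (delta w) v.
  by apply: iter_kop_ge0; exact: delta_ge0.
transitivity (\esum_(w in [set: T]) \esum_(v in [set: T])
    (k x w * (iter n (kop k) (delta v) w * f v))).
  by apply: eq_esum => w _; rewrite IH -ge0_esumZl// => v; rewrite mule_ge0.
rewrite exchange_esum; last by move=> i j; rewrite !mule_ge0.
apply: eq_esum => w _; rewrite muleC -ge0_esumZl//; last first.
  by move=> v; exact: mule_ge0.
by apply: eq_esum => v _; rewrite muleA muleC.
Qed.

(** The operator and the translation commute up to an inequality: the
    translated paths are only some of the paths that start from [s x]. *)
Lemma iter_kop_shift n (s : T -> T) f x : injective s -> (forall w, 0 <= f w) ->
  (forall x w, k x w <= k (s x) (s w)) ->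
  iter n (kop k) (f \o s) x <= iter n (kop k) f (s x).
Proof.
move=> sI f0 ks; elim: n x => [//|n IH] x.
apply: (@le_trans _ _
    (\esum_(w in [set: T]) (k (s x) (s w) * iter n (kop k) f (s w)))).
  apply: le_esum => w _; apply: lee_pmul => //; last exact: IH.
  by apply: iter_kop_ge0 => v; exact: f0.
apply: (@reindex_le_esum s (fun w => k (s x) w * iter n (kop k) f w)) => // w.
by rewrite mule_ge0// iter_kop_ge0.
Qed.

End fixed_kernel.
End Operators.

(** * Counting the translations along a path *)

Section MarkedSteps.
Context {R : realType} {T : choiceType}.
Variables (q : T -> T -> \bar R) (s : T -> T) (eps : R) (f0 : T -> \bar R).
Local Open Scope ereal_scope.

Definition mixop (f : T -> \bar R) (x : T) := kop q f x + eps%:E * f (s x).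

(** The expectation, starting from [x], of [phi N * f0 X], where [X] is the
    position after [n] steps of [mixop] and [N] is the number of these steps
    that were made by the translation [s]. Carrying a general weight [phi]
    allows to treat the words with a given number of translations together,
    by linearity in [phi]. *)
Fixpoint marked (n : nat) (phi : nat -> R) (x : T) : \bar R :=
  if n is m.+1 then
    kop q (marked m phi) x + eps%:E * marked m (fun j => phi j.+1) (s x)
  else (phi 0%N)%:E * f0 x.

Hypothesis q0 : forall x w, 0 <= q x w.
Hypothesis eps0 : (0 < eps)%R.
Hypothesis f00 : forall x, 0 <= f0 x.
Hypothesis f01 : forall x, f0 x <= 1.
Hypothesis mix1 : forall x, mixop (cst 1) x <= 1.
Hypothesis mix_shift : forall f x, (forall w, 0 <= f w) ->
  mixop (f \o s) x <= mixop f (s x).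

Let epsE0 : 0 <= eps%:E. Proof. by rewrite lee_fin ltW. Qed.

Lemma mixop_ge0 f x : (forall w, 0 <= f w) -> 0 <= mixop f x.
Proof. by move=> fp; rewrite adde_ge0 ?mule_ge0 ?kop_ge0. Qed.

Lemma iter_mixop_ge0 n x : 0 <= iter n mixop f0 x.
Proof. by elim: n x => [//|n IH] x /=; apply: mixop_ge0. Qed.

Lemma marked_ge0 n phi x : (forall j, (0 <= phi j)%R) -> 0 <= marked n phi x.
Proof.
elim: n phi x => [|n IH] phi x phi0 /=; first by rewrite mule_ge0 ?lee_fin.
rewrite adde_ge0//; first by apply: kop_ge0 => // w; apply: IH.
by rewrite mule_ge0// IH.
Qed.

Lemma le_marked n phi psi x : (forall j, (phi j <= psi j)%R) ->
  marked n phi x <= marked n psi x.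
Proof.
elim: n phi psi x => [|n IH] phi psi x le_phi /=.
  by rewrite lee_wpmul2r// lee_fin.
apply: leeD; first by apply: le_kop => // w; apply: IH.
by apply: lee_wpmul2l => //; apply: IH.
Qed.

Lemma markedD n phi psi x :
  (forall j, (0 <= phi j)%R) -> (forall j, (0 <= psi j)%R) ->
  marked n (fun j => phi j + psi j)%R x = marked n phi x + marked n psi x.
Proof.
elim: n phi psi x => [|n IH] phi psi x phi0 psi0 /=.
  by rewrite EFinD ge0_muleDl ?lee_fin.
rewrite addeACA -ge0_muleDr ?marked_ge0// -kopD//; last 2 first.
- by move=> w; rewrite marked_ge0.
- by move=> w; rewrite marked_ge0.
rewrite (IH (fun j => phi j.+1) (fun j => psi j.+1))//; congr (_ + _).
by apply: eq_esum => w _; rewrite IH.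
Qed.

Lemma markedZ n (c : R) phi x : (0 <= c)%R -> (forall j, (0 <= phi j)%R) ->
  marked n (fun j => c * phi j)%R x = c%:E * marked n phi x.
Proof.
move=> c0; elim: n phi x => [|n IH] phi x phi0 /=.
  by rewrite EFinM muleA.
rewrite ge0_muleDr ?kop_ge0 ?mule_ge0 ?marked_ge0//; last first.
  by move=> w; rewrite marked_ge0.
rewrite -kopZ//; last by move=> w; rewrite marked_ge0.
rewrite (IH (fun j => phi j.+1))// muleCA; congr (_ + _).
by apply: eq_esum => w _; rewrite IH.
Qed.

Lemma marked1 n x : marked n (fun=> 1%R) x = iter n mixop f0 x.
Proof.
elim: n x => [|n IH] x /=; first by rewrite mul1e.
by rewrite IH; congr (_ + _); apply: eq_esum => w _; rewrite IH.
Qed.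

(** The first step is a translation with weight [eps]. If it is one of the
    other steps of the path that is a translation, [mix_shift] moves it to the
    front, and each of the [n.+1] positions contributes at most
    [eps * iter n mixop f0 (s x)]. *)
Lemma marked_count_le n x :
  marked n.+1 (fun j => j%:R) x <= (n.+1%:R * eps)%:E * iter n mixop f0 (s x).
Proof.
elim: n x => [|n IH] x.
  rewrite /= mul1e mul1r [X in X + _](_ : _ = 0) ?add0e//.
  by apply: esum1 => w _; rewrite mul0e mule0.
have cnt0 (j : nat) : (0 <= j%:R :> R)%R by rewrite ler0n.
have -> : marked n.+2 (fun j => j%:R) x =
    mixop (marked n.+1 (fun j => j%:R)) x + eps%:E * iter n.+1 mixop f0 (s x).
  rewrite -marked1 /mixop -addeA -ge0_muleDr ?marked_ge0//.
  have /funext natS : (fun j => j.+1%:R : R) =1 (fun j => j%:R + 1)%R.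
    by move=> j; rewrite -natr1.
  by rewrite -markedD// -natS.
move: (marked n.+1 _) IH => M IH.
have -> : (n.+2%:R * eps)%:E = (n.+1%:R * eps)%:E + eps%:E.
  by rewrite -EFinD -natr1 mulrDl mul1r.
rewrite [leRHS]ge0_muleDl ?lee_fin ?mulr_ge0 ?(ltW eps0)//.
apply: leeD => //.
have c0 : 0 <= (n.+1%:R * eps)%:E by rewrite lee_fin mulr_ge0// ltW.
apply: (@le_trans _ _
  ((n.+1%:R * eps)%:E * mixop (iter n mixop f0 \o s) x)); last first.
  apply: lee_wpmul2l => //; apply: mix_shift => w; exact: iter_mixop_ge0.
rewrite /mixop ge0_muleDr ?mule_ge0 ?kop_ge0 ?iter_mixop_ge0//; last first.
  by move=> w; rewrite iter_mixop_ge0.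
rewrite -kopZ//; last by move=> w; rewrite iter_mixop_ge0.
rewrite muleCA; apply: leeD; first by apply: le_kop.
by apply: lee_wpmul2l.
Qed.

(** The Laplace transform of a binomial distribution. *)
Lemma marked_exp_le n (t : R) x :
  marked n (fun j => expR (- (t * j%:R))) x <=
  ((1 - eps + eps * expR (- t)) ^+ n)%:E.
Proof.
have e0 (j : nat) : (0 <= expR (- (t * j%:R)))%R by exact: expR_ge0.
have qle w : kop q (cst 1) w <= (1 - eps)%:E.
  by have := mix1 w; rewrite /mixop mule1 EFinB leeBrDr.
have eps1 : (0 <= 1 - eps)%R.
  by rewrite -lee_fin (le_trans _ (qle x))// kop_ge0.
set c := (1 - eps + _)%R.
have c0 : (0 <= c)%R by rewrite addr_ge0// mulr_ge0// ?expR_ge0// ltW.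
elim: n x => [|n IH] x /=.
  by rewrite mulr0 oppr0 expR0 mul1e expr0.
have -> : (fun j => expR (- (t * j.+1%:R))) =
    (fun j => expR (- t) * expR (- (t * j%:R)))%R.
  by apply/funext => j; rewrite -expRD -natr1; congr expR; ring.
rewrite markedZ ?expR_ge0//.
apply: (@le_trans _ _ ((c ^+ n)%:E * (1 - eps)%:E +
                       (eps * expR (- t))%:E * (c ^+ n)%:E)).
  apply: leeD.
    apply: le_trans (lee_wpmul2l _ (qle x)); last by rewrite lee_fin exprn_ge0.
    rewrite -kopZ ?lee_fin ?exprn_ge0//.
    by apply: le_kop => // w; rewrite mule1.
  rewrite muleA -EFinM lee_wpmul2l// lee_fin mulr_ge0 ?expR_ge0// ltW//.
by rewrite -!EFinM -EFinD lee_fin exprS /c; lra.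
Qed.

(** Chernoff's bound in integrated form. With [A = (1 - dl) * n.+1 * eps],
    slightly below the mean number of translations, [A] is at most
    [j + A * expR (dl * (A - j))] for every [j]: the first term suffices when
    [j >= A], the second one otherwise. Taking expectations in [j] and
    bounding the two terms by [marked_count_le] and [marked_exp_le] gives the
    claim, because [1 - expR (- dl)] is at least [dl / (1 + dl)]. *)
Lemma mixop_shift_ratio n (dl : R) x : (0 < dl < 1)%R ->
  (1 - dl)%:E * iter n.+1 mixop f0 x <=
  iter n mixop f0 (s x) +
    (expR (- (eps * dl ^+ 3 / (1 + dl) * n.+1%:R)))%:E.
Proof.
move=> /andP[dl0 dl1].
set kap := (eps * dl ^+ 3 / (1 + dl))%R.
pose c := (n.+1%:R * eps)%R.
have c0 : (0 < c)%R by rewrite mulr_gt0.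
pose A := (c * (1 - dl))%R.
have A0 : (0 <= A)%R by rewrite mulr_ge0 ?(ltW c0)// subr_ge0 ltW.
pose tilt (j : nat) := (A * expR (dl * A) * expR (- (dl * j%:R)))%R.
have B0 : (0 <= A * expR (dl * A))%R by rewrite mulr_ge0 ?expR_ge0.
have tilt0 j : (0 <= tilt j)%R by rewrite mulr_ge0 ?expR_ge0.
have cnt0 (j : nat) : (0 <= j%:R :> R)%R by rewrite ler0n.
have split_le j : (A <= j%:R + tilt j)%R.
  rewrite /tilt -mulrA -expRD.
  have [Aj|jA] := leP A j%:R.
    by rewrite (le_trans Aj)// lerDl mulr_ge0 ?expR_ge0.
  apply: (@le_trans _ _ (A * 1)%R); first by rewrite mulr1.
  rewrite (@le_trans _ _ (A * expR (dl * A + - (dl * j%:R))))%R// ?lerDr//.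
  rewrite ler_wpM2l// (le_trans _ (expR_ge1Dx _))// lerDl.
  rewrite -mulrN -mulrDr mulr_ge0 ?(ltW dl0)//.
  by rewrite subr_ge0 ltW.
have expo : (expR (dl * A) * (1 - eps + eps * expR (- dl)) ^+ n.+1 <=
    expR (- (kap * n.+1%:R)))%R.
  have le1 : (1 - eps + eps * expR (- dl) <=
      expR (- (eps * (1 - expR (- dl)))))%R.
    by apply: le_trans (expR_ge1Dx _); lra.
  have eps1 : (0 <= 1 - eps)%R.
    have := le_trans _ (mix1 x); rewrite /mixop mule1 => /(_ eps%:E).
    by rewrite leeDr ?kop_ge0// lee_fin subr_ge0; apply.
  apply: (@le_trans _ _ (expR (dl * A) *
      expR (- (eps * (1 - expR (- dl)))) ^+ n.+1))%R.
    rewrite ler_wpM2l ?expR_ge0// lerXn2r// nnegrE ?expR_ge0//.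
    by rewrite addr_ge0// mulr_ge0 ?expR_ge0// ltW.
  rewrite -expRM_natl -expRD ler_expR.
  have inv_le : (expR (- dl) <= (1 + dl)^-1)%R.
    rewrite expRN lef_pV2 ?posrE ?expR_gt0 ?expR_ge1Dx//; lra.
  have ne : (1 + dl != 0)%R by rewrite gt_eqF// addr_gt0.
  have -> : (- (kap * n.+1%:R) =
      dl * A - n.+1%:R * (eps * (1 - (1 + dl)^-1)))%R.
    by rewrite /kap /A /c; field.
  rewrite mulrN lerD2l lerN2 ler_wpM2l// ler_wpM2l ?(ltW eps0)//.
  by rewrite lerB.
have main : A%:E * iter n.+1 mixop f0 x <=
    c%:E * iter n mixop f0 (s x) + A%:E * (expR (- (kap * n.+1%:R)))%:E.
  rewrite -marked1 -markedZ//.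
  apply: (@le_trans _ _ (marked n.+1 (fun j => j%:R + tilt j)%R x)).
    by apply: le_marked => j; rewrite mulr1.
  rewrite markedD//; apply: leeD; first exact: marked_count_le.
  have exp0 (j : nat) : (0 <= expR (- (dl * j%:R)))%R by exact: expR_ge0.
  rewrite (markedZ _ _ B0 exp0).
  apply: (@le_trans _ _ ((A * expR (dl * A))%:E *
      ((1 - eps + eps * expR (- dl)) ^+ n.+1)%:E)).
    by rewrite lee_wpmul2l ?lee_fin// marked_exp_le.
  by rewrite -!EFinM lee_fin -mulrA ler_wpM2l.
have cE : (0 < c%:E)%E by rewrite lte_fin.
rewrite -(lee_pmul2l _ cE)// muleA -EFinM (le_trans main)//.
rewrite ge0_muleDr ?iter_mixop_ge0 ?lee_fin ?expR_ge0// leeD2l//.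
rewrite -!EFinM lee_fin ler_wpM2r ?expR_ge0// /A.
by rewrite ler_piMr ?(ltW c0)//; lra.
Qed.

End MarkedSteps.

(** * Green functions of kernels *)

Section GreenFunction.
Context {R : realType} {T : choiceType}.
Variable k : T -> T -> \bar R.
Local Open Scope ereal_scope.
Hypothesis k0 : forall x w, 0 <= k x w.

Definition ktrans (n : nat) (x y : T) : \bar R := iter n (kop k) (delta y) x.
Definition kgreen (x y : T) : \bar R := \sum_(0 <= n <oo) ktrans n x y.

Lemma ktrans_ge0 n x y : 0 <= ktrans n x y.
Proof. by apply: iter_kop_ge0 => // w; exact: delta_ge0. Qed.

Lemma kgreen_ge0 x y : 0 <= kgreen x y.
Proof. by apply: nneseries_ge0 => n _ _; exact: ktrans_ge0. Qed.

Lemma ktransM_le m n x w y : ktrans m x w * ktrans n w y <= ktrans (m + n) x y.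
Proof.
rewrite [leRHS]/ktrans iterD iter_kopE//; last by move=> v; exact: ktrans_ge0.
by apply: (@le_kop_term _ _ (ktrans m) _ (ktrans n ^~ y)) => *;
  exact: ktrans_ge0.
Qed.

Lemma ktransM_kgreen_le m x w y : ktrans m x w * kgreen w y <= kgreen x y.
Proof.
have -> : ktrans m x w * kgreen w y =
    \sum_(0 <= n <oo) (ktrans m x w * ktrans n w y).
  rewrite /kgreen !nneseries_esumT; last 2 first.
  - by move=> n; rewrite ?mule_ge0 ?ktrans_ge0.
  - by move=> n; rewrite ?mule_ge0 ?ktrans_ge0.
  by rewrite ge0_esumZl// => *; exact: ktrans_ge0.
apply: (@le_trans _ _ (\sum_(0 <= n <oo) ktrans (n + m) x y)).
  apply: lee_nneseries => [n _ _|n _]; first by rewrite mule_ge0 ?ktrans_ge0.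
  by rewrite addnC ktransM_le.
rewrite (nneseries_addn m (f := fun n => ktrans n x y)); last first.
  by move=> n; exact: ktrans_ge0.
rewrite [leRHS](nneseries_split 0 m)//; last by move=> *; exact: ktrans_ge0.
by rewrite add0n leeDr// sume_ge0// => *; exact: ktrans_ge0.
Qed.

(** The probability to visit [y] at one of the times [1], ..., [n]. *)
Fixpoint hitting (y : T) (n : nat) (x : T) : \bar R :=
  if n is m.+1 then kop k (fun w => if w == y then 1 else hitting y m w) x
  else 0.

Lemma hitting_ge0 y n x : 0 <= hitting y n x.
Proof.
elim: n x => [//|n IH] x /=; apply: kop_ge0 => // w.
by case: ifP => _; rewrite ?lee01.
Qed.

Let gsum (n : nat) x y : \bar R := \sum_(0 <= m < n) ktrans m x y.

Let gsum_ge0 n x y : 0 <= gsum n x y.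
Proof. by apply: sume_ge0 => m _; exact: ktrans_ge0. Qed.

Let gsumS n x y : gsum n.+1 x y = delta y x + kop k (fun w => gsum n w y) x.
Proof.
elim: n => [|n IH].
  rewrite /gsum big_nat1 [kop _ _ _]esum1 ?adde0// => w _.
  by rewrite big_geq// mule0.
rewrite /gsum big_nat_recr//= -/(gsum _ _ _) IH -addeA; congr (_ + _).
rewrite -[in LHS]kopD//; last by move=> w; exact: ktrans_ge0.
by apply: eq_esum => w _; rewrite /gsum big_nat_recr.
Qed.

(* From a point other than [y], the expected number of visits to [y] before
   time [n] is at most the probability to reach [y] times the expected number
   of visits when starting at [y]. *)
Let gsum_hitting n x y :
  gsum n x y <= (if x == y then 1 else hitting y n x) * gsum n y y.
Proof.
elim: n x => [|n IH] x.
  by rewrite {1}/gsum big_geq// mule_ge0//; case: ifP.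
have [->|xy] := eqVneq x y; first by rewrite mul1e.
rewrite gsumS {1}/delta (negPf xy) add0e /=.
apply: (@le_trans _ _ (hitting y n.+1 x * gsum n y y)); last first.
  rewrite lee_wpmul2l//; first exact: (hitting_ge0 y n.+1).
  by rewrite /gsum [leRHS]big_nat_recr//= leeDl// ktrans_ge0.
rewrite muleC /= -kopZ//; last first.
  by move=> w; case: ifP => _; rewrite ?lee01 ?hitting_ge0.
by apply: le_kop => // w; rewrite muleC.
Qed.

(** The renewal inequality [g (n + 1) <= 1 + r * g n] for the expected number
    [g n] of visits to [y] before time [n] keeps [g] below its fixed point
    [1 / (1 - r)]. *)
Lemma kgreen_diag_le y (r : R) : (r < 1)%R ->
  (forall n, hitting y n y <= r%:E) -> kgreen y y <= ((1 - r)^-1)%:E.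
Proof.
move=> r1 hr.
have r0 : (0 <= r)%R by rewrite -lee_fin; exact: le_trans (hr 0%N).
have r1' : (0 < 1 - r)%R by rewrite subr_gt0.
have gle n : gsum n y y <= ((1 - r)^-1)%:E.
  elim: n => [|n IH].
    by rewrite /gsum big_geq// lee_fin invr_ge0 ltW.
  rewrite gsumS {1}/delta eqxx.
  apply: (@le_trans _ _ (1 + hitting y n.+1 y * gsum n y y)).
    rewrite leeD2l// muleC /= -kopZ//; last first.
      by move=> w; case: ifP => _; rewrite ?lee01 ?hitting_ge0.
    by apply: le_kop => // w; rewrite muleC gsum_hitting.
  apply: (@le_trans _ _ (1 + r%:E * ((1 - r)^-1)%:E)).
    by rewrite leeD2l// lee_pmul// hitting_ge0.
  rewrite -EFinM -EFinD lee_fin le_eqVlt; apply/orP; left; apply/eqP; field.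
  by rewrite gt_eqF.
apply: lime_le.
  by apply: is_cvg_nneseries => n _ _; exact: ktrans_ge0.
by apply: nearW.
Qed.

(** Doob's transform: [expR (h w - h x) * k x w] has total mass at most
    [expR L]. *)
Lemma ktrans_exp_le (h : T -> R) (L : R) :
  (forall x, kop k (fun w => (expR (h w - h x))%:E) x <= (expR L)%:E) ->
  forall n x y, ktrans n x y <= (expR (L * n%:R + h x - h y))%:E.
Proof.
move=> hL n x y; elim: n x => [|n IH] x.
  rewrite /ktrans/= /delta lee_fin mulr0 add0r.
  by case: eqP => [->|_]; rewrite ?subrr ?expR0//= expR_ge0.
pose c := expR (L * n%:R + h x - h y).
apply: (@le_trans _ _ (kop k (fun w => c%:E * (expR (h w - h x))%:E) x)).
  apply: le_kop => // w; apply: le_trans (IH w) _.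
  rewrite -EFinM lee_fin /c -expRD ler_expR; lra.
have e0 w : 0 <= (expR (h w - h x))%:E by rewrite lee_fin expR_ge0.
rewrite kopZ ?lee_fin ?expR_ge0//.
apply: (@le_trans _ _ (c%:E * (expR L)%:E)).
  by rewrite lee_wpmul2l ?lee_fin ?expR_ge0.
rewrite -EFinM lee_fin /c -expRD ler_expR -natr1; lra.
Qed.

End GreenFunction.

Section ShiftComparison.
Context {R : realType} {T : choiceType}.
Variables (k : T -> T -> \bar R) (s : T -> T) (nt : nat) (eps : R).
Local Open Scope ereal_scope.
Hypothesis k0 : forall x w, 0 <= k x w.
Hypothesis k1 : forall x, kop k (cst 1) x <= 1.
Hypothesis sI : injective s.
Hypothesis ks : forall x w, k x w <= k (s x) (s w).
Hypothesis nt0 : (0 < nt)%N.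
Hypothesis eps0 : (0 < eps)%R.
Hypothesis k_eps : forall x, eps%:E <= ktrans k nt x (s x).

(* What remains of [nt] steps once the translation is taken out with weight
   [eps]. *)
Let q (x w : T) : \bar R := ktrans k nt x w - (eps * (s x == w)%:R)%:E.

Let q0 x w : 0 <= q x w.
Proof.
rewrite /q sube_ge0//; case: eqP => [<-|_]; first by rewrite mulr1.
by rewrite mulr0 ktrans_ge0.
Qed.

Let mixopE f x : (forall w, 0 <= f w) ->
  mixop q s eps f x = iter nt (kop k) f x.
Proof.
move=> f0; rewrite iter_kopE// /mixop.
rewrite -(esum_delta (s x) f0) -ge0_esumZl; last 2 first.
- by rewrite lee_fin ltW.
- by move=> w; rewrite mule_ge0// delta_ge0.
rewrite /kop -esumD; last 2 first.
- by move=> w _; rewrite mule_ge0.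
- by move=> w _; rewrite !mule_ge0 ?lee_fin ?(ltW eps0)// delta_ge0.
apply: eq_esum => w _; rewrite muleA -ge0_muleDl//; last first.
  by rewrite mule_ge0 ?lee_fin ?(ltW eps0)// delta_ge0.
by rewrite /delta eq_sym -EFinM subeK.
Qed.

Let iter_mixopE n f x : (forall w, 0 <= f w) ->
  iter n (mixop q s eps) f x = iter (n * nt) (kop k) f x.
Proof.
move=> f0; elim: n x => [//|n IH] x; rewrite iterS mulSn iterD.
have /funext -> : iter n (mixop q s eps) f =1 iter (n * nt) (kop k) f.
  exact: IH.
by rewrite mixopE// => w; apply: iter_kop_ge0.
Qed.

(** Time [m] is split into blocks of [nt] steps, to which [mixop_shift_ratio]
    applies, and a remainder, which is absorbed into the function on which the
    blocks act. For [m < nt] the exponential term exceeds [1]. *)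
Lemma ktrans_shift_ratio (dl : R) : (0 < dl < 1)%R ->
  exists2 kap : R, (0 < kap)%R & forall m x y,
    (1 - dl)%:E * ktrans k m x y <=
    (if (m < nt)%N then 0 else ktrans k (m - nt) (s x) y) +
    (expR (kap * nt%:R - kap * m%:R))%:E.
Proof.
move=> dl01; have /andP[dl0 dl1] := dl01.
pose kap0 := (eps * dl ^+ 3 / (1 + dl))%R.
have kap00 : (0 < kap0)%R by rewrite divr_gt0 ?mulr_gt0 ?exprn_gt0// addr_gt0.
have ntR : (0 < nt%:R :> R)%R by rewrite ltr0n.
exists (kap0 / nt%:R)%R; first by rewrite divr_gt0.
move=> m x y.
have [mnt|ntm] := ltnP m nt.
  rewrite add0e; apply: (@le_trans _ _ 1).
    rewrite -[leRHS]mule1 lee_pmul ?ktrans_ge0 ?lee_fin ?subr_ge0 ?(ltW dl1)//.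
      by rewrite gerBl ltW.
    by apply: iter_kop_le1 => // w; rewrite /delta lee_fin lern1 leq_b1.
  rewrite lee_fin -mulrBr (le_trans _ (expR_ge1Dx _))// lerDl mulr_ge0//.
    by rewrite ltW// divr_gt0.
  by rewrite subr_ge0 ler_nat ltnW.
have [n mE] : exists n, (m = n.+1 * nt + m %% nt)%N.
  exists (m %/ nt).-1; rewrite prednK ?divn_gt0//; exact: divn_eq.
pose f0 w := ktrans k (m %% nt) w y.
have f00 w : 0 <= f0 w by exact: ktrans_ge0.
have f01 w : f0 w <= 1.
  by apply: iter_kop_le1 => // v; rewrite /delta lee_fin lern1 leq_b1.
have mix1 w : mixop q s eps (cst 1) w <= 1.
  by rewrite mixopE//; apply: iter_kop_le1.
have mix_shift f w : (forall v, 0 <= f v) ->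
    mixop q s eps (f \o s) w <= mixop q s eps f (s w).
  move=> fp; rewrite !mixopE//; first exact: iter_kop_shift.
  by move=> v; exact: fp.
have := mixop_shift_ratio q0 eps0 f00 f01 mix1 mix_shift n x dl01.
rewrite !iter_mixopE// /f0 /ktrans -!iterD -mE.
have -> : (n * nt + m %% nt = m - nt)%N.
  by rewrite [in RHS]mE mulSn -addnA addKn.
move=> /le_trans; apply; rewrite leeD2l// lee_fin ler_expR -/kap0.
have kapE : kap0 = (kap0 / nt%:R * nt%:R)%R by rewrite divfK// gt_eqF.
have e0 : (0 <= kap0 / nt%:R)%R by rewrite ltW// divr_gt0.
have mle : (m%:R <= n.+1%:R * nt%:R + nt%:R :> R)%R.
  by rewrite -natrM -natrD ler_nat {1}mE leq_add2l ltnW// ltn_pmod.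
rewrite {1}kapE; move: (kap0 / nt%:R)%R e0 => e e0; nra.
Qed.

(** The excess of [(1 - dl) * ktrans k m x y] over its translated counterpart
    is at most [expR (L * m - D)] and at most [expR (kap * nt - kap * m)],
    hence at most the geometric mean of these bounds with weights [t] and
    [1 - t]. The choice of [t] makes the coefficient of [m] in the exponent
    equal to [- kap / 2], so that the mean is summable in [m], while it keeps
    the factor [expR (- t * D)]. *)
Lemma kgreen_shift (L dl : R) : (0 <= L)%R -> (0 < dl < 1)%R ->
  exists C t : R, [/\ (0 < C)%R, (0 < t)%R & forall x y (D : R),
    (forall n, ktrans k n x y <= (expR (L * n%:R - D))%:E) ->
    (1 - dl)%:E * kgreen k x y <= kgreen k (s x) y + (C * expR (- (t * D)))%:E].
Proof.
move=> L0 dl01; have /andP[dl0 dl1] := dl01.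
have [kap kap0 ratio] := ktrans_shift_ratio dl01.
pose t := (kap / (2 * (kap + L)))%R.
have kL : (0 < kap + L)%R by rewrite ltr_wpDr.
have t0 : (0 < t)%R by rewrite divr_gt0// mulr_gt0.
have tE : (t * (kap + L) = kap / 2)%R by rewrite /t; field; rewrite gt_eqF.
have t1 : (t < 1)%R.
  by rewrite /t ltr_pdivrMr ?mulr_gt0//; lra.
pose z := expR (- (kap / 2)).
have z1 : (z < 1)%R by rewrite expR_lt1 oppr_lt0 divr_gt0.
have z0 : (0 < z)%R by exact: expR_gt0.
exists (expR (kap * nt%:R) / (1 - z))%R, t; split => //.
  by rewrite divr_gt0 ?expR_gt0// subr_gt0.
move=> x y D up.
pose b m := if (m < nt)%N then 0 else ktrans k (m - nt) (s x) y.
have b0 m : 0 <= b m by rewrite /b; case: ifP => // _; exact: ktrans_ge0.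
pose c := (expR (kap * nt%:R) * expR (- (t * D)))%R.
have c0 : (0 <= c)%R by rewrite mulr_ge0// expR_ge0.
have term m : (1 - dl)%:E * ktrans k m x y <= b m + (c * z ^+ m)%:E.
  have kfin : ktrans k m x y \is a fin_num.
    by rewrite ge0_fin_numE ?ktrans_ge0// (le_lt_trans (up m)) ?ltry.
  move: (ratio m x y) (up m); rewrite -/(b m) -(fineK kfin).
  have bfin : b m \is a fin_num.
    rewrite ge0_fin_numE// (@le_lt_trans _ _ 1) ?ltry// /b; case: ifP => // _.
    by apply: iter_kop_le1 => // v; rewrite /delta lee_fin lern1 leq_b1.
  have a0 : (0 <= fine (ktrans k m x y))%R by rewrite fine_ge0// ktrans_ge0.
  move: (fine (ktrans k m x y)) a0 => a a0.
  have := b0 m; rewrite -(fineK bfin); move: (fine (b m)) => bm.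
  rewrite -!EFinM -!EFinD !lee_fin => bm0 le1 le2.
  have -> : (c * z ^+ m =
      expR (kap * nt%:R - t * D - kap / 2 * m%:R))%R.
    rewrite /c /z -expRM_natl -!expRD; congr expR; ring.
  rewrite -lerBlDl; rewrite -lerBlDl in le1.
  have le2' : ((1 - dl) * a - bm <= expR (L * m%:R - D))%R.
    by apply: le_trans le2; nra.
  move: ((1 - dl) * a - bm)%R le1 le2' => X le1 le2'.
  have ntR : (0 <= nt%:R :> R)%R by rewrite ler0n.
  have e : (t * (L * m%:R - D) + (1 - t) * (kap * nt%:R - kap * m%:R) <=
            kap * nt%:R - t * D - kap / 2 * m%:R)%R.
    rewrite -subr_ge0.
    have -> : (kap * nt%:R - t * D - kap / 2 * m%:R -
        (t * (L * m%:R - D) + (1 - t) * (kap * nt%:R - kap * m%:R)) =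
      t * (kap * nt%:R) + m%:R * (kap / 2 - t * (kap + L)))%R by field.
    by rewrite tE subrr mulr0 addr0 mulr_ge0 ?(ltW t0)// mulr_ge0 ?(ltW kap0).
  apply: le_trans _ (_ : expR (t * (L * m%:R - D) +
      (1 - t) * (kap * nt%:R - kap * m%:R)) <= _)%R; last by rewrite ler_expR.
  move: (L * m%:R - D)%R (kap * nt%:R - kap * m%:R)%R le1 le2' => A B le1 {}le2.
  have [AB|/ltW BA] := leP A B.
    apply: le_trans le2 _; rewrite ler_expR -subr_ge0.
    have -> : (t * A + (1 - t) * B - A = (1 - t) * (B - A))%R by ring.
    by rewrite mulr_ge0// subr_ge0// ltW.
  apply: le_trans le1 _; rewrite ler_expR -subr_ge0.
  have -> : (t * A + (1 - t) * B - B = t * (A - B))%R by ring.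
  by rewrite mulr_ge0 ?subr_ge0// ltW.
apply: (@le_trans _ _ (\sum_(0 <= m <oo) (b m + (c * z ^+ m)%:E))).
  rewrite -nneseriesZl; last by move=> *; exact: ktrans_ge0.
  apply: lee_nneseries => [m _ _|m _//].
  by rewrite mule_ge0 ?ktrans_ge0// lee_fin subr_ge0 ltW.
have zm m : 0 <= (c * z ^+ m)%:E by rewrite lee_fin mulr_ge0// exprn_ge0// ltW.
rewrite nneseriesD//; apply: leeD.
  rewrite (nneseries_split 0 nt)// add0n [X in X + _]big1_seq; last first.
    by move=> m; rewrite mem_index_iota => /andP[_ /andP[_ mn]]; rewrite /b mn.
  rewrite add0e -nneseries_addn//.
  apply: lee_nneseries => [m _ _//|m _].
  by rewrite /b ltnNge leq_addl/= addnK.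
apply: lime_le; first by apply: is_cvg_nneseries.
apply: nearW => n; rewrite sumEFin lee_fin.
have -> : (expR (kap * nt%:R) / (1 - z) * expR (- (t * D)) = c / (1 - z))%R.
  by rewrite /c mulrAC.
by apply: (geometric_le_lim n) => //; rewrite ger0_norm// ltW.
Qed.

End ShiftComparison.

(** * Transition kernel of a Markov chain *)

Section CountablePartition.
Local Open Scope ereal_scope.

Lemma measure_partition {R : realType} {dO} {Omega : measurableType dO}
    {S : countType} (mu : {measure set Omega -> \bar R}) (X : Omega -> S)
    (A : set Omega) :
  (forall t, measurable [set w | X w = t]) -> measurable A ->
  mu A = \esum_(t in [set: S]) mu (A `&` [set w | X w = t]).
Proof.
move=> mX mA.
pose F n := A `&` [set w | pickle (X w) = n].
have FE t : F (pickle t) = A `&` [set w | X w = t].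
  congr (_ `&` _); apply/seteqP; split => w /= => [/(pcan_inj pickleK)//|->//].
have F0 n : ~ range (@pickle S) n -> F n = set0.
  move=> nr; apply/seteqP; split => w //= -[_ /= wn].
  by apply: nr; exists (X w).
have mF n : measurable (F n).
  have [[t _ <-]|/F0 ->//] := pselect (range (@pickle S) n).
  by rewrite FE; exact: measurableI.
have UF : \bigcup_n F n = A.
  apply/seteqP; split => [w [n _ []]//|w Aw].
  by exists (pickle (X w)).
rewrite -{1}UF measure_semi_bigcup//; last 2 first.
- by move=> i j _ _ [w [[_ /= <-] [_ /= <-]]].
- by rewrite UF.
rewrite nneseries_esumT//.
under [RHS]eq_esum do rewrite -FE.
rewrite -(@esum_image _ _ _ setT (@pickle S) (fun n => mu (F n))); last first.
  by move=> i j _ _ /(pcan_inj pickleK).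
rewrite [RHS]esum_mkcond; apply: eq_esum => n _.
case: ifPn => // /negP nr; rewrite F0 ?measure0// => r; apply: nr.
by rewrite inE.
Qed.

End CountablePartition.

Section Chain.
Context {R : realType} {d : nat} (E : set 'rV[int]_d)
  (p : 'rV[int]_d -> 'rV[int]_d -> R)
  {dO : measure_display} {Omega : measurableType dO}
  (P : 'rV[int]_d -> probability Omega R)
  (Z : nat -> Omega -> option 'rV[int]_d).
Hypothesis p0 : forall x y, E x -> E y -> 0 <= p x y.
Hypothesis hZ : markov_chain E p P Z.
Local Open Scope ereal_scope.

Definition pker (x y : E) : \bar R := (p (\val x) (\val y))%:E.

Lemma pker_ge0 x y : 0 <= pker x y.
Proof. by rewrite lee_fin; apply: p0; exact: set_valP. Qed.

(** The extension by zero of a function on [E] to the cemetery (and to all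
    other points, which are not states). *)
Definition on_states (f : E -> \bar R) (t : option 'rV[int]_d) : \bar R :=
  oapp f 0 (obind insub t).

Lemma on_states_val f x : on_states f (Some (\val x)) = f x.
Proof. by rewrite /on_states/= valK. Qed.

Lemma on_states_out f t : ~ is_state E t -> on_states f t = 0.
Proof.
case: t => [y|//] nEy; rewrite /on_states/=; case: insubP => //= z.
by rewrite inE.
Qed.

Lemma on_states_ge0 f t : (forall x, 0 <= f x) -> 0 <= on_states f t.
Proof. by move=> f0; rewrite /on_states; case: (obind _ _) => //=. Qed.

Lemma state_ind (Q : option 'rV[int]_d -> Prop) : Q None ->
  (forall x : E, Q (Some (\val x))) -> forall t, is_state E t -> Q t.
Proof.
move=> QN QS [x|//] Ex; have xE : x \in E by rewrite inE.
exact: (QS (exist _ x xE)).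
Qed.

Lemma esum_trans (g : E -> \bar R) t : (forall x, 0 <= g x) -> is_state E t ->
  \esum_(t' in [set: option 'rV[int]_d]) (trans E p t t' * on_states g t') =
  on_states (kop pker g) t.
Proof.
move=> g0; move: t; apply: state_ind => [|x].
  by apply: esum1 => -[y|] _ /=; rewrite ?mul0e ?mule0.
rewrite on_states_val.
pose e (w : E) := Some (\val w).
rewrite [RHS](_ : _ =
  \esum_(w in [set: E]) (trans E p (Some (\val x)) (e w) * on_states g (e w))).
  rewrite -(@esum_image _ _ _ setT e (fun t' =>
    trans E p (Some (\val x)) t' * on_states g t')); last first.
    by move=> i j _ _ [] /val_inj.
  rewrite [RHS]esum_mkcond; apply: eq_esum => t' _.
  case: ifPn => // /negP nr.
  case: t' nr => [y|] nr; last by rewrite /on_states/= mule0.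
  rewrite /on_states/=; case: insubP => /= [w _ wy|_]; last by rewrite mule0.
  by exfalso; apply: nr; rewrite inE; exists w => //; congr Some.
by apply: eq_esum => w _; rewrite on_states_val.
Qed.

Let mZ n t : measurable [set w | Z n w = t].
Proof. by case: hZ. Qed.

Let Zstate n w : is_state E (Z n w).
Proof. by case: hZ. Qed.

Let mhist s n : measurable (history Z s n).
Proof.
have -> : history Z s n = \bigcap_(k in `I_n.+1) [set w | Z k w = s k] by [].
by apply: fin_bigcap_measurable => // ; exact: finite_II.
Qed.

Definition extend (s : nat -> option 'rV[int]_d) n t (j : nat) :=
  if (j <= n)%N then s j else t.

Lemma history_extend s n t :
  history Z (extend s n t) n.+1 = history Z s n `&` [set w | Z n.+1 w = t].
Proof.
rewrite /extend; apply/seteqP; split => w /=.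
  move=> h; split; last by have := h n.+1 (leqnn _); rewrite ltnn.
  by move=> j jn; have := h j (leqW jn); rewrite jn.
move=> [h hn] j; rewrite leq_eqVlt ltnS => /orP[/eqP ->|jn].
  by rewrite ltnn.
by rewrite jn h.
Qed.

(** The Markov property for an event [A] whose conditional probability given
    the history up to time [n.+1] is a function [g] of the state at that time:
    summing over this state expresses the conditional probability of [A] given
    the history up to time [n]. That [on_states g] vanishes at the cemetery
    says that [A] does not occur once the chain has been absorbed. *)
Lemma markov_step x (A : set Omega) (g : E -> \bar R) n : E x -> measurable A ->
  (forall w, 0 <= g w) ->
  (forall s, (forall j, is_state E (s j)) ->
    P x (history Z s n.+1 `&` A) =
      P x (history Z s n.+1) * on_states g (s n.+1)) ->
  forall s, (forall j, is_state E (s j)) ->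
    P x (history Z s n `&` A) =
      P x (history Z s n) * on_states (kop pker g) (s n).
Proof.
move=> Ex mA g0 hA s ss.
rewrite (@measure_partition _ _ _ _ (P x) (Z n.+1)) //; last exact: measurableI.
rewrite -esum_trans// -ge0_esumZl; last 2 first.
- exact: measure_ge0.
- move=> t; have [st|nst] := pselect (is_state E t); last first.
    by rewrite on_states_out ?mule0.
  case: t st => [b|_]; last by rewrite /on_states/= mule0.
  move=> Eb; rewrite mule_ge0 ?on_states_ge0//.
  by case: (s n) (ss n) => [a|] //= Ea; rewrite lee_fin p0.
apply: eq_esum => t _; rewrite setIAC -history_extend.
have [st|nst] := pselect (is_state E t); last first.
  have -> : history Z (extend s n t) n.+1 = set0.
    apply/seteqP; split => w //= /(_ n.+1 (leqnn _)).
    by rewrite /extend ltnn => wt; apply: nst; rewrite -wt; exact: Zstate.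
  by rewrite set0I measure0 on_states_out ?mule0.
have se j : is_state E (extend s n t j) by rewrite /extend; case: ifP.
transitivity (P x (history Z (extend s n t) n.+1) *
              on_states g (extend s n t n.+1)); first exact: (hA _ se).
rewrite muleA; congr (_ * _); last by rewrite /extend ltnn.
case: hZ => _ _ _ /(_ x Ex _ n se) ->.
rewrite /extend leqnn ltnn; congr (P x _ * _).
by apply/seteqP; split => w h j jn; have := h j jn; rewrite jn.
Qed.

Lemma history_prob_at x m (y : E) : E x ->
  forall n s, (forall j, is_state E (s j)) ->
  P x (history Z s n `&` [set w | Z (n + m)%N w = Some (\val y)]) =
  P x (history Z s n) * on_states (ktrans pker m ^~ y) (s n).
Proof.
move=> Ex; elim: m => [|m IH] n s ss.
  rewrite addn0.
  have [sy|sny] := eqVneq (s n) (Some (\val y)).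
    rewrite sy on_states_val /ktrans/= /delta eqxx mule1; congr (P x _).
    by apply/seteqP; split => [w []//|w h]; split => //=; rewrite h.
  have -> : history Z s n `&` [set w | Z n w = Some (\val y)] = set0.
    apply/seteqP; split => w //= [/(_ n (leqnn n)) -> /eqP].
    by rewrite (negPf sny).
  rewrite measure0; move: (ss n) sny; move: (s n).
  apply: state_ind => [_|z]; first by rewrite /on_states/= mule0.
  rewrite on_states_val /ktrans/= /delta.
  by have [->|_] := eqVneq z y; rewrite ?eqxx// mule0.
apply: (@markov_step _ _ (fun z => ktrans pker m z y)) => //.
- by move=> w; apply: ktrans_ge0 => *; exact: pker_ge0.
- by move=> s' ss'; rewrite addnS -addSn IH.
Qed.

Lemma history_prob_hit x N (y : E) : E x ->
  forall n s, (forall j, is_state E (s j)) ->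
  P x (history Z s n `&`
       [set w | exists2 i, (i < N)%N & Z (n + i.+1)%N w = Some (\val y)]) =
  P x (history Z s n) * on_states (hitting pker y N) (s n).
Proof.
move=> Ex; have mE M n : measurable
    [set w | exists2 i, (i < M)%N & Z (n + i.+1)%N w = Some (\val y)].
  have -> : [set w | exists2 i, (i < M)%N & Z (n + i.+1)%N w = Some (\val y)] =
      \bigcup_(i in `I_M) [set w | Z (n + i.+1)%N w = Some (\val y)] by [].
  exact: bigcup_measurable.
elim: N => [|N IH] n s ss.
  rewrite [X in P x (_ `&` X)](_ : _ = set0) ?setI0 ?measure0; last first.
    by apply/seteqP; split => w // -[].
  move: (ss n); move: (s n).
  apply: state_ind => [|z]; first by rewrite /on_states/= mule0.
  by rewrite on_states_val/= mule0.
pose g w := if w == y then 1 else hitting pker y N w.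
apply: (@markov_step _ _ g) => //.
  move=> w; rewrite /g; case: ifP => // _; apply: hitting_ge0 => *.
  exact: pker_ge0.
move=> {s ss} s ss.
have [sy|sny] := eqVneq (s n.+1) (Some (\val y)).
  rewrite sy on_states_val /g eqxx mule1; congr (P x _).
  apply/seteqP; split => [w []//|w h]; split => //; exists 0%N => //.
  by rewrite addn1 h.
have -> : on_states g (s n.+1) =
    on_states (hitting pker y N) (s n.+1).
  move: (ss n.+1) sny; move: (s n.+1); apply: state_ind => // z.
  by rewrite !on_states_val /g; have [->|//] := eqVneq z y; rewrite eqxx.
rewrite -IH//; congr (P x _); apply/seteqP.
split => w [h [i iN wi]]; split => //.
  case: i iN wi => [|i] iN wi; last by exists i => //; rewrite addSnnS.
  by exfalso; move/eqP: sny; apply; rewrite -wi addn1 h.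
by exists i.+1 => //; rewrite -addSnnS.
Qed.

(* The history at time [0] is the starting point, which is almost sure. *)
Let history0 (x : E) (A : set Omega) : measurable A ->
  P (\val x) (history Z (fun=> Some (\val x)) 0 `&` A) = P (\val x) A.
Proof.
move=> mA.
have -> : history Z (fun=> Some (\val x)) 0 = [set w | Z 0%N w = Some (\val x)].
  apply/seteqP; split => w /=; first by move/(_ 0%N); apply.
  by move=> h j; rewrite leqn0 => /eqP ->.
have Ex : E (\val x) by exact: set_valP.
rewrite [RHS](measureDI _ mA (mZ 0 (Some (\val x)))) setIC.
rewrite [X in _ = X + _](_ : _ = 0) ?add0e//.
apply/eqP; rewrite eq_le measure_ge0 andbT.
apply: (@le_trans _ _ (P (\val x) (~` [set w | Z 0%N w = Some (\val x)]))).
  by apply: le_measure; rewrite ?inE//; [exact: measurableD|exact: measurableC].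
rewrite probability_setC//; case: hZ => _ _ -> // _.
by rewrite subee.
Qed.

Let history00 (x : E) : P (\val x) (history Z (fun=> Some (\val x)) 0) = 1.
Proof. by rewrite -(setIT (history _ _ _)) history0// probability_setT. Qed.

Let const_states (x : E) (j : nat) : is_state E (Some (\val x)).
Proof. exact: set_valP. Qed.

Lemma prob_at_ktrans (x y : E) m :
  P (\val x) [set w | Z m w = Some (\val y)] = ktrans pker m x y.
Proof.
have := @history_prob_at _ m y (set_valP x) 0%N _ (const_states x).
by rewrite history0// history00 mul1e on_states_val add0n.
Qed.

Lemma hitting_le_return (x : E) N : hitting pker x N x <=
  P (\val x) [set w | exists n : nat, (1 <= n)%N /\ Z n w = Some (\val x)].
Proof.
have := @history_prob_hit _ N x (set_valP x) 0%N _ (const_states x).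
rewrite history00 mul1e on_states_val => <-.
apply: le_measure; rewrite ?inE.
- apply: measurableI => //.
  have -> : [set w | exists2 i, (i < N)%N & Z (0 + i.+1)%N w = Some (\val x)] =
      \bigcup_(i in `I_N) [set w | Z (0 + i.+1)%N w = Some (\val x)] by [].
  exact: bigcup_measurable.
- have -> : [set w | exists n : nat, (1 <= n)%N /\ Z n w = Some (\val x)] =
      \bigcup_(n in [set n | (1 <= n)%N]) [set w | Z n w = Some (\val x)].
    by apply/seteqP; split => w [n] => [[]|]; [exists n|exists n].
  exact: bigcup_measurable.
- by move=> w [_ [i iN wi]]; exists i.+1.
Qed.

Lemma green_kgreen (x y : E) : green P Z (\val x) (\val y) = kgreen pker x y.
Proof. by apply: eq_eseriesr => n _; exact: prob_at_ktrans. Qed.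

End Chain.

(** * Lower limits, Euclidean norm and exponential bounds *)

Section LowerLimits.
Context {R : realType}.
Local Open Scope ereal_scope.

Lemma limn_einf_geP (v : nat -> \bar R) (l : R) :
  (forall e : R, (0 < e)%R -> \forall n \near \oo, (l - e)%:E <= v n) ->
  l%:E <= limn_einf v.
Proof.
move=> hv; apply/lee_subgt0Pr => e e0; rewrite limn_einf_lim -EFinB.
apply: lime_ge; first exact: is_cvg_einfs.
have [N _ hN] := hv e e0; exists N => // n /= Nn.
by apply: le_ereal_inf_tmp => _ [m /= nm <-]; apply: hN; exact: leq_trans nm.
Qed.

Lemma near_limn_einf_gt (v : nat -> \bar R) (x : \bar R) :
  x < limn_einf v -> \forall n \near \oo, x < v n.
Proof.
rewrite limn_einf_lim (cvg_lim _ (cvg_einfs_sup (u := v)))//.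
move=> /ereal_sup_gt[_ [N _ <-] xN]; exists N => // n /= Nn.
by apply: lt_le_trans xN _; apply: ereal_inf_lbound; exists n.
Qed.

Lemma expR_le_of_lne_div (g : \bar R) (N c : R) : (0 < N)%R ->
  (- c)%:E < lne g / N%:E -> (expR (- (c * N)))%:E <= g.
Proof.
move=> N0; rewrite inver gt_eqF// => lt_g.
have := ltW lt_g; rewrite lee_pdivlMr// -EFinM mulNr.
case: g {lt_g} => [g| |] //=; rewrite ?leey//.
case: ifPn => //; rewrite -ltNge => g0; rewrite !lee_fin => le_g.
by rewrite -[leRHS]lnK ?posrE// ler_expR.
Qed.

End LowerLimits.

Section EuclideanNorm.
Context {R : realType} {d : nat}.
Implicit Types (a b c : 'rV[R]_d).

Lemma dotpDr a b c : dotp a (b + c) = dotp a b + dotp a c.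
Proof.
by rewrite /dotp -big_split; apply: eq_bigr => i _; rewrite mxE mulrDr.
Qed.

Lemma dotpNr a b : dotp a (- b) = - dotp a b.
Proof. by rewrite /dotp -sumrN; apply: eq_bigr => i _; rewrite mxE mulrN. Qed.

Lemma dotpZl (r : R) a b : dotp (r *: a) b = r * dotp a b.
Proof.
by rewrite /dotp mulr_sumr; apply: eq_bigr => i _; rewrite mxE mulrA.
Qed.

Lemma dotpZr (r : R) a b : dotp a (r *: b) = r * dotp a b.
Proof.
by rewrite /dotp mulr_sumr; apply: eq_bigr => i _; rewrite mxE mulrCA.
Qed.

Lemma dotp_ge0 a : 0 <= dotp a a.
Proof. by apply: sumr_ge0 => i _; rewrite -expr2 sqr_ge0. Qed.

Lemma enorm_ge0 a : 0 <= enorm a.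
Proof. exact: sqrtr_ge0. Qed.

Lemma sqr_enorm a : enorm a ^+ 2 = dotp a a.
Proof. by rewrite sqr_sqrtr// dotp_ge0. Qed.

(** Follows from [a^2 <= 2 (a - b)^2 + 2 b^2], coordinate by coordinate. *)
Lemma enorm_half_le a b :
  2 * enorm b <= enorm a -> enorm a <= 2 * enorm (a - b).
Proof.
move=> ba; have a0 := enorm_ge0 a; have b0 := enorm_ge0 b.
rewrite -(@ler_sqr _) ?nnegrE ?mulr_ge0 ?enorm_ge0// exprMn !sqr_enorm.
have : dotp a a <= 2 * dotp (a - b) (a - b) + 2 * dotp b b.
  rewrite /dotp !mulr_sumr -big_split; apply: ler_sum => i _ /=; rewrite !mxE.
  by rewrite -subr_ge0; have := sqr_ge0 (a 0 i - 2 * b 0 i); lra.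
have : 4 * dotp b b <= dotp a a.
  by rewrite -!sqr_enorm; nra.
lra.
Qed.

Lemma realptB (x y : 'rV[int]_d) : realpt R (x - y) = realpt R x - realpt R y.
Proof. by apply/rowP => i; rewrite !mxE intrB. Qed.

Lemma dotp_attains_enorm (v : 'rV[R]_d) (r : R) : 0 <= r ->
  exists2 a : 'rV[R]_d, enorm a <= r & dotp a v = r * enorm v.
Proof.
move=> r0; have v0 := enorm_ge0 v.
exists ((r / enorm v) *: v); last first.
  rewrite dotpZl -sqr_enorm; have [->|vn0] := eqVneq (enorm v) 0.
    by rewrite expr0n !mulr0.
  by field.
rewrite -(@ler_sqr _) ?nnegrE ?enorm_ge0// sqr_enorm dotpZl dotpZr -sqr_enorm.
have [->|vn0] := eqVneq (enorm v) 0; first by rewrite invr0 mulr0 mul0r sqr_ge0.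
by rewrite le_eqVlt; apply/orP; left; apply/eqP; field.
Qed.

End EuclideanNorm.

Section ChainBounds.
Context {R : realType} {d : nat} (E : set 'rV[int]_d)
  (p : 'rV[int]_d -> 'rV[int]_d -> R).
Hypothesis p0 : forall x y, E x -> E y -> 0 <= p x y.
Local Open Scope ereal_scope.

Lemma esum_set_type (F : 'rV[int]_d -> \bar R) :
  \esum_(y in E) F y = \esum_(w in [set: E]) F (\val w).
Proof.
rewrite -(@esum_image _ _ _ setT (fun w : E => \val w)); last first.
  by move=> i j _ _ /val_inj.
congr esum; apply/seteqP; split => y /=.
  by move=> Ey; exists (exist _ y (mem_set Ey)).
by move=> [w _ <-]; exact: set_valP.
Qed.

(** [ktrans_exp_le] applied with the linear function [h = dotp a], where [a]
    has norm [r] and the direction of [y - x]. *)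
Lemma ktrans_le_exp_enorm (C r : R) : (0 < C)%R -> (0 < r)%R ->
  (forall a x, (enorm a <= r)%R -> E x -> exp_moment E p a x <= C%:E) ->
  exists2 L : R, (0 <= L)%R & forall n (x y : E),
    ktrans (pker p) n x y <=
    (expR (L * n%:R - r * enorm (realpt R (\val y - \val x))))%:E.
Proof.
move=> C0 r0 mom; exists (ln (Num.max C 1%R)).
  by rewrite ln_ge0// le_max lexx orbT.
have CL : (C <= expR (ln (Num.max C 1)))%R.
  by rewrite lnK ?le_max ?lexx// posrE lt_max C0.
move=> n x y.
have [a ar aE] := dotp_attains_enorm (realpt R (\val y - \val x)) (ltW r0).
rewrite -aE realptB dotpDr dotpNr.
pose h (w : E) := dotp a (realpt R (\val w)).
apply: (@le_trans _ _ (expR (ln (Num.max C 1) * n%:R + h x - h y))%:E).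
  apply: ktrans_exp_le => [|z]; first exact: pker_ge0.
  apply: le_trans (_ : _ <= C%:E) _; last by rewrite lee_fin.
  apply: le_trans (mom a (\val z) ar (set_valP z)).
  rewrite /exp_moment esum_set_type; apply: le_esum => w _.
  by rewrite realptB dotpDr dotpNr EFinM.
by rewrite lee_fin ler_expR /h; lra.
Qed.

End ChainBounds.

(** * The ratio limit theorem *)

Section RatioLimit.
Context {R : realType}.
Local Open Scope ereal_scope.

(** Here [G] and [G'] are [G(z, y)] and [G(z + u, y)], [G0] is [G(0, y)], and
    [N], [D] are the norms of [y] and [y - z]. As [G >= gam * expR (- c N)]
    and [D >= N / 2], the error is smaller than [G] by the factor
    [C / gam * expR (- c N)], which is at most [dl] by the lower bound on
    [N]. *)
Lemma ratio_ge_of_small_error (G G' G0 : \bar R) (N D c C gam dl : R) :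
  (0 < gam)%R -> (0 < C)%R -> (0 < c)%R -> (0 < dl < 1)%R ->
  0 <= G' -> G < +oo ->
  (0 < N)%R -> (C / (c * dl * gam) <= N)%R -> (N <= 2 * D)%R ->
  (expR (- (c * N)))%:E <= G0 -> gam%:E * G0 <= G ->
  (1 - dl)%:E * G <= G' + (C * expR (- (4 * c * D)))%:E ->
  (1 - 2 * dl)%:E <= G' / G.
Proof.
move=> gam0 C0 c0 /andP[dl0 dl1] G'0 Gfin N0 Nlarge ND lbG0 G0G main.
pose e := expR (- (c * N)).
have e0 : (0 < e)%R by exact: expR_gt0.
have lbG : (gam * e)%:E <= G.
  by apply: le_trans G0G; rewrite EFinM lee_wpmul2l// lee_fin ltW.
have ge0 : (0 < gam * e)%R by rewrite mulr_gt0.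
have err : (C * expR (- (4 * c * D)) <= dl * (gam * e))%R.
  apply: (@le_trans _ _ (C * (e * e)))%R.
    by rewrite ler_wpM2l ?(ltW C0)// /e -expRD ler_expR; nra.
  rewrite !mulrA ler_wpM2r ?(ltW e0)//.
  have eN : (e <= (c * N)^-1)%R.
    rewrite /e expRN lef_pV2 ?posrE ?expR_gt0 ?mulr_gt0//.
    by apply: le_trans (expR_ge1Dx _); lra.
  apply: (@le_trans _ _ (C * (c * N)^-1))%R; first by rewrite ler_pM2l.
  rewrite ler_pdivrMr ?mulr_gt0//.
  by rewrite ler_pdivrMr ?mulr_gt0// in Nlarge; lra.
case: G Gfin lbG {G0G} main => [G _| //|]; last by [].
rewrite lee_fin => lbG; have G0' : (0 < G)%R by exact: lt_le_trans lbG.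
case: G' G'0 => [G'| |]// G'0; last first.
  by rewrite inver gt_eqF// gt0_mulye ?leey// lte_fin invr_gt0.
rewrite -EFinM -EFinD lee_fin inver gt_eqF// -EFinM lee_fin => main.
rewrite ler_pdivlMr//.
have : (dl * (gam * e) <= dl * G)%R by rewrite ler_wpM2l// ltW.
lra.
Qed.

End RatioLimit.

Theorem theorem1 (R : realType) (d : nat) (E : set 'rV[int]_d)
    (p : 'rV[int]_d -> 'rV[int]_d -> R)
    (dO : measure_display) (Omega : measurableType dO)
    (P : 'rV[int]_d -> probability Omega R)
    (Z : nat -> Omega -> option 'rV[int]_d)
    (u : 'rV[int]_d) (y : nat -> 'rV[int]_d)
    (h0 : E 0)
    (hp : substochastic E p)
    (hZ : markov_chain E p P Z)
    (htrans : transient_on E P Z)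
    (A1 : irreducible_on E P Z)
    (A2 : exists C delta0 : R, [/\ 0 < C, 0 < delta0 &
       (ereal_sup [set ereal_sup [set exp_moment E p alpha x | x in E]
                  | alpha in [set alpha : 'rV[R]_d | enorm alpha <= delta0]%R]
          < C%:E)%E])
    (A3 : [/\ u != 0,
              forall x, E x -> E (x + u)
            & forall x z, E x -> E z -> p x z <= p (x + u) (z + u)])
    (A4 : exists2 nt : nat, (1 <= nt)%N &
       (0 < ereal_inf [set P x [set w | Z nt w = Some (x + u)%R] | x in E])%E)
    (hyE : forall n, E (y n))
    (hynorm : (fun n => enorm (realpt R (y n))) @ \oo --> +oo)
    (hyG : (0 <= limn_einf (fun n =>
              lne (green P Z 0%R (y n)) / (enorm (realpt R (y n)))%:E))%E) :
  forall z, E z ->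
    (1 <= limn_einf (fun n =>
            green P Z (z + u)%R (y n) / green P Z z (y n)))%E.
Proof.
have [p0 p1] := hp; have [u0 Eu pu] := A3.
have k0 : forall x w : E, (0 <= pker p x w)%E by exact: pker_ge0.
have k1 (x : E) : (kop (pker p) (cst 1%E) x <= 1)%E.
  apply: le_trans (p1 _ (set_valP x)); rewrite esum_set_type.
  by apply: le_esum => w _; rewrite mule1.
pose s (x : E) : E := exist _ (\val x + u) (mem_set (Eu _ (set_valP x))).
have sI : injective s by move=> a b /(congr1 val) /addIr /val_inj.
have ks (x w : E) : (pker p x w <= pker p (s x) (s w))%E.
  by rewrite lee_fin; apply: pu; exact: set_valP.
have kE := prob_at_ktrans p0 hZ.
have conn (x w : E) : exists n, (0 < ktrans (pker p) n x w)%E.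
  have [n hn] := A1 _ _ (set_valP x) (set_valP w).
  by exists n; rewrite -kE.
have kle1 n (x w : E) : (ktrans (pker p) n x w <= 1)%E.
  by apply: iter_kop_le1 => // v; rewrite /delta lee_fin lern1 leq_b1.
have gfin (x w : E) : (kgreen (pker p) x w < +oo)%E.
  have ret := htrans _ (set_valP w).
  set rho := P _ _ in ret.
  have rfin : rho \is a fin_num.
    rewrite ge0_fin_numE; last exact: measure_ge0.
    exact: lt_le_trans ret (leey _).
  have diag : (kgreen (pker p) w w < +oo)%E.
    apply: le_lt_trans (_ : _ <= ((1 - fine rho)^-1)%:E)%E _; last exact: ltry.
    apply: kgreen_diag_le => //; first by rewrite -lte_fin fineK.
    by move=> n; rewrite fineK//; exact: hitting_le_return.
  (* An infinite value at [x] would propagate to [w], from where [x] can be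
     reached. *)
  have [m m0] := conn w x.
  have := ktransM_kgreen_le k0 m w x w.
  rewrite ltNge; apply: contraPN; rewrite leye_eq => /eqP ->.
  by rewrite gt0_muley// => /le_lt_trans /(_ diag).
have [nt nt0 infpos] := A4.
set I := ereal_inf _ in infpos.
have Ile (x : E) : (I <= ktrans (pker p) nt x (s x))%E.
  rewrite -kE; apply: ereal_inf_lbound; exists (\val x) => //; exact: set_valP.
pose o : E := exist _ 0 (mem_set h0).
have Ifin : I \is a fin_num.
  rewrite ge0_fin_numE ?(ltW infpos)// (le_lt_trans (Ile o))//.
  by rewrite (le_lt_trans (kle1 _ _ _))// ltry.
have eps0 : 0 < fine I by rewrite fine_gt0// infpos (le_lt_trans (Ile o))//
  (le_lt_trans (kle1 _ _ _))// ltry.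
have keps (x : E) : ((fine I)%:E <= ktrans (pker p) nt x (s x))%E.
  by rewrite fineK.
have [C0 [r [C00 r0 mom]]] := A2.
have mom_le a x : enorm a <= r -> E x -> (exp_moment E p a x <= C0%:E)%E.
  move=> ar Ex; apply: le_trans (ltW mom).
  apply: (@le_trans _ _ (ereal_sup [set exp_moment E p a x | x in E])).
    by apply: ereal_sup_ubound; exists x.
  by apply: ereal_sup_ubound; exists a.
have [L L0 upper] := ktrans_le_exp_enorm p0 C00 r0 mom_le.
pose Y n : E := exist _ (y n) (mem_set (hyE n)).
move=> z Ez; pose x : E := exist _ z (mem_set Ez).
have [m m0] := conn x o.
have mfin : ktrans (pker p) m x o \is a fin_num.
  by rewrite ge0_fin_numE ?(ltW m0)// (le_lt_trans (kle1 _ _ _))// ltry.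
pose gam := fine (ktrans (pker p) m x o).
have gam0 : 0 < gam by rewrite fine_gt0// m0 (le_lt_trans (kle1 _ _ _))// ltry.
apply: limn_einf_geP => e e0.
pose dl := Num.min (e / 2) (1 / 2).
have dl01 : 0 < dl < 1.
  by rewrite lt_min gt_min !divr_gt0//=; apply/orP; right; lra.
have dle : 2 * dl <= e.
  by have : dl <= e / 2 by [rewrite ge_min lexx]; lra.
have [C [t [C_gt0 t0 shift]]] := kgreen_shift k0 k1 sI ks nt0 eps0 keps L0 dl01.
(* A quarter of the decay rate of the error: one half is lost in replacing
   the norm of [y n - z] by that of [y n], and the lower bound on the Green
   function may use only half of what remains. *)
pose c := t * r / 4.
have c0 : 0 < c by rewrite divr_gt0// mulr_gt0.
have large : \forall n \near \oo,
    Num.max 1 (Num.max (2 * enorm (realpt R z)) (C / (c * dl * gam))) <=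
    enorm (realpt R (y n)).
  by move/cvgryPge: hynorm; apply.
have lower : \forall n \near \oo, ((- c)%:E <
    lne (green P Z 0%R (y n)) / (enorm (realpt R (y n)))%:E)%E.
  apply: near_limn_einf_gt; apply: lt_le_trans hyG.
  by rewrite lte_fin oppr_lt0.
near=> n.
have : Num.max 1 (Num.max (2 * enorm (realpt R z)) (C / (c * dl * gam))) <=
    enorm (realpt R (y n)) by near: n.
rewrite !ge_max => /and3P[N1 Nz NC].
have N0 : 0 < enorm (realpt R (y n)) by exact: lt_le_trans N1.
apply: (@le_trans _ _ (1 - 2 * dl)%:E); first by rewrite lee_fin lerB.
have gE := green_kgreen p0 hZ.
rewrite (gE (s x) (Y n)) (gE x (Y n)).
apply: (@ratio_ge_of_small_error _ _ _ (green P Z 0 (y n))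
  (enorm (realpt R (y n))) (enorm (realpt R (y n - z))) c C gam) => //.
- exact: kgreen_ge0.
- by rewrite realptB; exact: enorm_half_le.
- by apply: expR_le_of_lne_div => //; near: n.
- by rewrite (gE o (Y n)) /gam fineK//; exact: ktransM_kgreen_le.
- have -> : 4 * c * enorm (realpt R (y n - z)) =
      t * (r * enorm (realpt R (y n - z))).
    by rewrite /c; field.
  by apply: shift => k; exact: upper.
Unshelve. all: by end_near.
Qed.
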